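(* For every $\varepsilon \in (0, 1/2)$ there exists a constant $D = D(\varepsilon)$, depending only on $\varepsilon$ and not on the dimension, such that for every integer $n \ge 1$ the following holds. If $S_n \subset \mathbb{R}^n$ is an $n$-dimensional ball of unit volume and $A, B \subseteq S_n$ are convex subsets, each of $n$-dimensional volume $\varepsilon$, then $\mathrm{dist}(A, B) \le D$.
   Context: For sets $A, B \subset \mathbb{R}^n$, $\mathrm{dist}(A,B) = \inf_{X \in A,\, Y \in B} \mathrm{dist}(X,Y)$, where $\mathrm{dist}(X,Y)$ is the Euclidean distance between the points $X$ and $Y$. Volume means $n$-dimensional Lebesgue measure. *)

(* Defs.v *)
From HB Require Import structures.
From mathcomp Require Import all_boot all_order all_algebra.
From mathcomp Require Import all_classical all_reals all_analysis.

Set Implicit Arguments.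
Unset Strict Implicit.
Unset Printing Implicit Defensive.

Import Order.TTheory GRing.Theory Num.Theory.
Local Open Scope classical_set_scope.
Local Open Scope ring_scope.

(* The n-fold product of the one-dimensional Lebesgue measure.  The values are
   meaningful on measurable sets only: outside the product sigma-algebra the
   iterated integral behind [\x] is an arbitrary value. *)
Fixpoint lebesgue_tuple (R : realType) (n : nat) :
    set (n.-tuple (measurableTypeR R)) -> \bar R :=
  if n is m.+1 then
    pushforward (lebesgue_measure \x lebesgue_tuple (R := R) (n := m))%E
      (fun p : measurableTypeR R * m.-tuple (measurableTypeR R) =>
         [tuple of p.1 :: p.2])
  else \d_([tuple])%E.

(* n-dimensional Lebesgue measure, as the completion of the product measure.
   The completion is given by the outer measure [mu_ext], which only evaluates
   [lebesgue_tuple] on measurable covers; it extends [lebesgue_tuple] and its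
   Caratheodory-measurable sets are the Lebesgue measurable sets.  The
   completion matters: a convex set is always Lebesgue measurable (its boundary
   is negligible) but, for n >= 2, need not be Borel.  Row vectors are read as
   tuples of coordinates. *)
Definition volume (R : realType) (n : nat) (A : set 'rV[R]_n) : \bar R :=
  mu_ext (@lebesgue_tuple R n)
    [set t : n.-tuple (measurableTypeR R) | A (\row_(i < n) tnth t i)].

(* Defined by hand because the library norm on row vectors is the sup norm. *)
Definition eucl_dist (R : realType) (n : nat) (X Y : 'rV[R]_n) : R :=
  Num.sqrt (\sum_(i < n) (X 0 i - Y 0 i) ^+ 2).

Definition set_dist (R : realType) (n : nat) (A B : set 'rV[R]_n) : R :=
  inf [set eucl_dist X Y | X in A & Y in B].

(* Open and closed balls are both allowed. *)
Definition eucl_ball (R : realType) (n : nat) (S : set 'rV[R]_n) : Prop :=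
  exists (c : 'rV[R]_n) (r : R), 0 < r /\
    (S = [set X | eucl_dist c X < r] \/ S = [set X | eucl_dist c X <= r]).

(* Main.v *)
(* Convexity plays no role.  Suppose that [dist(A, B) > D := 1 / eps] and that the
   ball has centre [c] and radius [r].  By the parallelogram law every midpoint of a
   point of [A] and a point of [B] lies within [s] of [c], where
   [s ^ 2 = r ^ 2 - D ^ 2 / 4].  By the multiplicative Brunn-Minkowski inequality the
   midpoints have volume at least [eps], so that [eps <= (s / r) ^ n].  The cube
   inscribed in the ball has volume at most [1], which gives [4 r ^ 2 <= n] and hence
   [eps ^ 2 <= (1 - D ^ 2 / n) ^ n <= exp (- D ^ 2) < 1 / D ^ 2 = eps ^ 2].

   The Brunn-Minkowski inequality comes from the Prekopa-Leindler inequality for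
   midpoints, which passes to products by Fubini and thus follows the recursive
   definition of the measure.  On the line it follows from
   [|K| + |L| <= 2 |(K + L) / 2|] applied to superlevel sets.  As [A] and [B] need not
   be Borel, they are first replaced by Borel sets between them and their closures. *)
From HB Require Import structures.
Require Import Defs.
From mathcomp Require Import all_boot all_order all_algebra.
From mathcomp Require Import all_classical all_reals all_analysis.
From mathcomp Require Import measurable_realfun ring lra.
Import Order.TTheory GRing.Theory Num.Theory.
Import numFieldNormedType.Exports.
Local Open Scope classical_set_scope.
Local Open Scope ring_scope.

Set Implicit Arguments.
Unset Strict Implicit.
Unset Printing Implicit Defensive.

Local Notation tup R n := (n.-tuple (measurableTypeR R)).

(** * The n-dimensional Lebesgue measure as a measure *)

Definition tcons (R : realType) n (p : measurableTypeR R * tup R n) : tup R n.+1 :=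
  [tuple of p.1 :: p.2].

Definition tuncons (R : realType) n (t : tup R n.+1) : measurableTypeR R * tup R n :=
  (thead t, [tuple of behead t]).

Lemma tconsK (R : realType) n : cancel (@tcons R n) (@tuncons R n).
Proof.
case=> x t; rewrite /tuncons theadE/=.
by rewrite (_ : [tuple of behead (tcons (x, t))] = t) //; exact/val_inj.
Qed.

Lemma tunconsK (R : realType) n : cancel (@tuncons R n) (@tcons R n).
Proof. by move=> t; rewrite /tcons/= [RHS]tuple_eta. Qed.

Lemma measurable_tcons (R : realType) n : measurable_fun setT (@tcons R n).
Proof. exact: (measurable_cons measurable_fst measurable_snd). Qed.

Lemma measurable_tuncons (R : realType) n : measurable_fun setT (@tuncons R n).
Proof.
apply: measurable_fun_pair; [exact: measurable_tnth|exact: measurable_behead].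
Qed.

(* The canonical sigma-finite structure that the library declares on products is
   shadowed by the one for subprobabilities, so it cannot be inferred here. *)
Lemma sigma_finite_pushforward_tcons (R : realType) n
    (mu : {sigma_finite_measure set (tup R n) -> \bar R}) :
  sigma_finite setT (pushforward (@lebesgue_measure R \x mu)%E (@tcons R n)).
Proof.
have /sigma_finiteP[F [TF ndF Foo]] := sigma_finiteT (@lebesgue_measure R).
have /sigma_finiteP[G [TG ndG Goo]] := sigma_finiteT mu.
(* Both exhaustions are nondecreasing, so a point with coordinates in [F i] and [G j] lies in the
   box of index [maxn i j]. *)
exists (fun k => @tuncons R n @^-1` (F k `*` G k)).
  rewrite -preimage_bigcup -(preimage_setT (@tuncons R n)); congr (_ @^-1` _).
  apply/seteqP; split => // -[x t] _.
  have [i _ Fix] : (\bigcup_i F i) x by rewrite -TF.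
  have [j _ Gjt] : (\bigcup_i G i) t by rewrite -TG.
  exists (maxn i j) => //; split => /=.
    by have /subsetPset := ndF _ _ (leq_maxl i j); exact.
  by have /subsetPset := ndG _ _ (leq_maxr i j); exact.
move=> k; have [[mF Fk] [mG Gk]] := (Foo k, Goo k); split.
  rewrite -[X in measurable X]setTI; apply: measurable_tuncons => //.
  exact: measurableX.
rewrite /pushforward (_ : _ @^-1` _ = F k `*` G k); last first.
  by rewrite -comp_preimage (_ : _ \o _ = id)//; apply/funext/tconsK.
by rewrite product_measure1E// lte_mul_pinfty// ge0_fin_numE.
Qed.

Lemma sigma_finite_measure_of d (T : measurableType d) (R : realType)
    (m : {measure set T -> \bar R}) : sigma_finite setT m ->
  exists mu : {sigma_finite_measure set T -> \bar R},
    mu = m :> (set _ -> \bar R).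
Proof.
move=> sf.
pose sfin := @isSFinite.Build _ _ _ (Measure.sort m)
  (sfinite_measure_sigma_finite sf).
pose sigfin := @isSigmaFinite.Build _ _ _ (Measure.sort m) sf.
pose mu : {sigma_finite_measure set T -> \bar R} :=
  HB.pack (Measure.sort m) sfin sigfin.
by exists mu.
Qed.

(** The product construction yields a measure from bundled sigma-finite factors, so the induction on
    the dimension carries a bundled measure along. *)
Lemma lebesgue_tuple_sigma_finite_measure (R : realType) n :
  exists mu : {sigma_finite_measure set (tup R n) -> \bar R},
    mu = @lebesgue_tuple R n :> (set _ -> \bar R).
Proof.
elim: n => [|n [mu muE]] /=.
  by exists (\d_[tuple] : {sigma_finite_measure set (tup R 0) -> \bar R}).
rewrite -muE; apply: sigma_finite_measure_of; first exact: measurable_tcons.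
by move=> mt; exact: sigma_finite_pushforward_tcons.
Qed.

Section lebesgue_tuple_measure.
Context (R : realType) (n : nat).
Local Notation mu := (@lebesgue_tuple R n).

Let mu0 : mu set0 = 0%E.
Proof. by have [m <-] := lebesgue_tuple_sigma_finite_measure R n. Qed.

Let mu_ge0 A : (0 <= mu A)%E.
Proof. by have [m <-] := lebesgue_tuple_sigma_finite_measure R n. Qed.

Let mu_additive : semi_sigma_additive mu.
Proof.
have [m <-] := lebesgue_tuple_sigma_finite_measure R n.
exact: measure_semi_sigma_additive.
Qed.

Let mu_sigma_finite : sigma_finite setT mu.
Proof.
have [m <-] := lebesgue_tuple_sigma_finite_measure R n.
exact: sigma_finiteT.
Qed.

HB.instance Definition _ := isMeasure.Build _ _ _ mu mu0 mu_ge0 mu_additive.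
HB.instance Definition _ := Measure_isSigmaFinite.Build _ _ _ mu mu_sigma_finite.

End lebesgue_tuple_measure.

(** * The Prekopa-Leindler inequality on the line *)

Local Open Scope ereal_scope.

(** A finite [y] can be subtracted; if [y] is infinite, one element of [X] already forces [c = +oo].
    This allows inner approximation in one summand at a time. *)
Lemma ereal_supD_le (R : realType) (X : set (\bar R)) (y c : \bar R) :
  X !=set0 -> (forall x, X x -> 0 <= x) -> 0 <= y ->
  (forall x, X x -> x + y <= c) -> ereal_sup X + y <= c.
Proof.
move=> [x Xx] X0; case: y => [y| |] // y0 Xc.
  rewrite -leeBrDr//; apply: ge_ereal_sup => z Xz.
  by rewrite leeBrDr//; exact: Xc.
have := Xc _ Xx; rewrite addey; last by rewrite gt_eqF// (lt_le_trans _ (X0 _ Xx)).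
by rewrite leye_eq => /eqP ->; rewrite leey.
Qed.

Lemma ereal_supM_le (R : realType) (X : set (\bar R)) (y c : \bar R) :
  X !=set0 -> (forall x, X x -> 0 <= x) -> 0 <= y ->
  (forall x, X x -> x * y <= c) -> ereal_sup X * y <= c.
Proof.
move=> [x Xx] X0 y0 Xc.
have c0 : 0 <= c by rewrite (le_trans _ (Xc _ Xx))// mule_ge0// X0.
have [->|yN0] := eqVneq y 0; first by rewrite mule0.
case: y => [y| |] // in y0 yN0 Xc *.
  have y_gt0 : (0 < y)%R by rewrite -lte_fin lt_def yN0.
  by rewrite -lee_pdivlMr//; apply: ge_ereal_sup => z Xz; rewrite lee_pdivlMr// Xc.
(* Here [y = +oo]: a zero supremum gives the product 0 by convention, and otherwise a positive
   element of [X] forces [c = +oo]. *)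
have [supX|] := leP (ereal_sup X) 0.
  rewrite (_ : ereal_sup X = 0) ?mul0e//; apply/eqP; rewrite eq_le supX/=.
  by rewrite (le_trans (X0 _ Xx))//; exact: ereal_sup_ubound.
move=> /ereal_sup_gt[z Xz z0].
by have := Xc _ Xz; rewrite gt0_muley// leye_eq => /eqP ->; rewrite leey.
Qed.

(** AM-GM: [4 x y <= (x + y) ^ 2 <= 4 z ^ 2]. It turns the additive inequality for normalized
    functions into the multiplicative one. *)
Lemma sqre_ge_mul (R : realType) (x y z : \bar R) :
  0 <= x -> 0 <= y -> x + y <= 2%:E * z -> x * y <= z * z.
Proof.
case: z => [z| |]; last 2 first.
- by rewrite mulyy leey.
- by rewrite mulNyNy leey.
case: x => [x| |]//; case: y => [y| |]//=.
rewrite -!EFinM -EFinD !lee_fin => x0 y0 xyz.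
have := sqr_ge0 (x - y)%R; have : (0 <= (2 * z - (x + y)) * (2 * z + (x + y)))%R.
  by apply: mulr_ge0; lra.
lra.
Qed.

Definition affine (R : realType) (a b : R) (x : measurableTypeR R) :
  measurableTypeR R := (a * x + b)%R.

Lemma measurable_affine (R : realType) (a b : R) :
  measurable_fun setT (affine a b).
Proof. by apply: measurable_funD => //; exact: measurable_funM. Qed.

Lemma measurable_preimage_affine (R : realType) (a b : R)
    (A : set (measurableTypeR R)) :
  measurable A -> measurable (affine a b @^-1` A).
Proof.
by move=> mA; rewrite -[X in measurable X]setTI; exact: measurable_affine.
Qed.

(** The pushforward scaled by [a] agrees with Lebesgue measure on half-open intervals, hence
    everywhere by uniqueness. *)
Lemma lebesgue_measure_affine (R : realType) (a b : R)
    (A : set (measurableTypeR R)) : (0 < a)%R -> measurable A ->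
  lebesgue_measure (affine a b @^-1` A) = (a^-1)%:E * lebesgue_measure A.
Proof.
move=> a0 mA; have mf := @measurable_affine R a b.
have fitv (p : R * R) : affine a b @^-1` `]p.1, p.2]%classic =
    `]((p.1 - b) / a)%R, ((p.2 - b) / a)%R]%classic.
  apply/seteqP; split => t /=;
    by rewrite !in_itv/= ltr_pdivrMr// ler_pdivlMr// ltrBlDr lerBrDr mulrC.
have lE := @lebesgue_measure_unique R (mscale (NngNum (ltW a0))
  (pushforward lebesgue_measure (affine a b))).
rewrite (lE mf _ A mA); first by rewrite /mscale/= muleA -EFinM mulVf ?gt_eqF// mul1e.
move=> _ [p _ <-].
transitivity (a%:E * lebesgue_measure (affine a b @^-1` `]p.1, p.2]%classic)) => //.
rewrite fitv !lebesgue_measure_itv/= !lte_fin.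
rewrite ltr_pM2r ?invr_gt0// ltrD2r; case: ifPn => // _; last by rewrite mule0.
by rewrite -!EFinB -EFinM; congr EFin; field; lra.
Qed.

Lemma brunn_minkowski_compact (R : realType) (K L M : set (measurableTypeR R)) :
  measurable M -> K !=set0 -> L !=set0 ->
  compact (K : set R) -> compact (L : set R) ->
  (forall x y, K x -> L y -> M ((x + y) / 2)%R) ->
  lebesgue_measure K + lebesgue_measure L <= 2%:E * lebesgue_measure M.
Proof.
move=> mM K0 L0 cK cL KLM.
have mK : measurable K by exact: compact_measurable.
have mL : measurable L by exact: compact_measurable.
have [p /set_mem Kp pmax] := @compact_EVT_max _ _ (@idfun R) K K0 cK
  (@continuous_subspaceT _ _ _ _ (fun=> cvg_id)).
have [q /set_mem Lq qmin] := @compact_EVT_min _ _ (@idfun R) L L0 cL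
  (@continuous_subspaceT _ _ _ _ (fun=> cvg_id)).
pose f c := @affine R 2 (- c)%R.
have mfK : measurable (f q @^-1` K) by exact: measurable_preimage_affine.
have mfL : measurable (f p @^-1` L) by exact: measurable_preimage_affine.
pose w : measurableTypeR R := ((p + q) / 2)%R.
have mw : measurable [set w] by exact: measurable_set1.
have mfKw : measurable (f q @^-1` K `\ w) by exact: measurableD.
(* [(K + q) / 2] and [(p + L) / 2] lie in [M] and meet in [w] only, where
   [p] is the maximum of [K] and [q] the minimum of [L]. *)
have fKfL : (f q @^-1` K `\ w) `&` (f p @^-1` L) = set0.
  apply/seteqP; split => // z [[Kz zw] Lz]; apply: zw => /=.
  have := pmax _ (mem_set Kz); have := qmin _ (mem_set Lz).
  rewrite /f /affine /w /=; lra.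
have subM : (f q @^-1` K `\ w) `|` (f p @^-1` L) `<=` M.
  move=> z [[Kz _]|Lz].
    by rewrite (_ : z = (f q z + q) / 2)%R; [exact: KLM|rewrite /f /affine; field].
  by rewrite (_ : z = (p + f p z) / 2)%R; [exact: KLM|rewrite /f /affine; field].
(* Removing the common point makes the two pieces disjoint and costs no measure. *)
have le1 : lebesgue_measure (f q @^-1` K) <= lebesgue_measure (f q @^-1` K `\ w).
  rewrite -[leRHS]adde0 -(lebesgue_measure_set1 w).
  apply: le_trans (measureU2 _ mfKw mw).
  apply: le_measure; rewrite ?inE//; first exact: measurableU.
  by move=> z Kz; have [->|/eqP zw] := eqVneq z w; [right|left].
have : lebesgue_measure (f q @^-1` K) + lebesgue_measure (f p @^-1` L) <=
    lebesgue_measure M.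
  apply: le_trans (leeD le1 (lexx _)) _; rewrite -measureU//.
  by apply: le_measure; rewrite ?inE//; exact: measurableU.
rewrite !lebesgue_measure_affine// -ge0_muleDr//.
by rewrite -lee_pdivrMl.
Qed.

(** Inner regularity reduces the claim to compact subsets, first of [K] and then of [L]. *)
Lemma brunn_minkowski1 (R : realType) (K L M : set (measurableTypeR R)) :
  measurable K -> measurable L -> measurable M -> K !=set0 -> L !=set0 ->
  (forall x y, K x -> L y -> M ((x + y) / 2)%R) ->
  lebesgue_measure K + lebesgue_measure L <= 2%:E * lebesgue_measure M.
Proof.
move=> mK mL mM [p Kp] [q Lq] KLM.
rewrite (lebesgue_regularity_inner_sup mK); apply: ereal_supD_le => //.
- by exists 0; exists set0; rewrite ?measure0//=; split=> //; exact: compact0.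
- by move=> _ [K' _ <-].
move=> _ [K' [cK' K'K] <-].
rewrite addeC (lebesgue_regularity_inner_sup mL); apply: ereal_supD_le => //.
- by exists 0; exists set0; rewrite ?measure0//=; split=> //; exact: compact0.
- by move=> _ [L' _ <-].
move=> _ [L' [cL' L'L] <-]; rewrite addeC.
(* The compact subsets may be empty; adjoining [p] and [q] keeps them nonempty. *)
have cKp : compact (K' `|` [set p] : set R) by apply: compactU => //; exact: compact_set1.
have cLq : compact (L' `|` [set q] : set R) by apply: compactU => //; exact: compact_set1.
have mK' : measurable (K' : set (measurableTypeR R)) by exact: compact_measurable.
have mL' : measurable (L' : set (measurableTypeR R)) by exact: compact_measurable.
have mKp : measurable (K' `|` [set p] : set (measurableTypeR R)) by exact: compact_measurable.
have mLq : measurable (L' `|` [set q] : set (measurableTypeR R)) by exact: compact_measurable.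
apply: le_trans (@brunn_minkowski_compact R _ _ M mM _ _ cKp cLq _).
- by apply: leeD; apply: le_measure; rewrite ?inE//; exact: subsetUl.
- by exists p; right.
- by exists q; right.
by move=> x y [/K'K Kx|->] [/L'L Ly|->]; exact: KLM.
Qed.

(** * The layer-cake formula *)

Section layer_cake.
Context d (T : measurableType d) (R : realType).
Variables (mu : {sigma_finite_measure set T -> \bar R}) (f : T -> \bar R).
Hypotheses (mf : measurable_fun setT f) (f0 : forall x, 0 <= f x).

(** The condition on the sign of [t] lets the layer-cake integral run over the whole line. *)
Definition superlevel (t : measurableTypeR R) : set T :=
  [set x | (0 < t)%R /\ t%:E < f x].

Let hypograph : set (T * measurableTypeR R) :=
  [set p | (0 < p.2)%R /\ p.2%:E < f p.1].

Let measurable_hypograph : measurable hypograph.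
Proof.
have m2 : measurable_fun setT (fun p : T * measurableTypeR R => p.2%:E).
  exact/measurable_EFinP.
have mf1 : measurable_fun setT (fun p : T * measurableTypeR R => f p.1).
  exact: measurableT_comp.
rewrite (_ : hypograph = [set p | 0 < p.2%:E] `&` [set p | 0 < f p.1 - p.2%:E]).
  apply: measurableI; rewrite -[X in measurable X]setTI.
    exact: emeasurable_fun_o_infty.
  by apply: emeasurable_fun_o_infty => //; exact: emeasurable_funB.
by apply/seteqP; split => p; rewrite /hypograph /setI /mkset lte_fin sube_gt0.
Qed.

Let ysection_hypograph t : ysection hypograph t = superlevel t.
Proof. by apply/seteqP; split => x; rewrite /ysection/= inE. Qed.

Lemma measurable_superlevel t : measurable (superlevel t).
Proof. by rewrite -ysection_hypograph; exact: measurable_ysection. Qed.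

Lemma measurable_fun_superlevel : measurable_fun setT (mu \o superlevel).
Proof.
rewrite (_ : superlevel = ysection hypograph); first exact: measurable_fun_ysection.
by apply/funext => t; rewrite ysection_hypograph.
Qed.

(** Tonelli on the region under the graph: its section at [x] is an interval of length [f x], its
    section at height [t] is a superlevel set. *)
Lemma layer_cake :
  \int[mu]_x f x = \int[@lebesgue_measure R]_t mu (superlevel t).
Proof.
have := @indic_fubini_tonelli _ _ _ _ _ mu (@lebesgue_measure R) _ measurable_hypograph.
rewrite indic_fubini_tonelli_FE// indic_fubini_tonelli_GE//= => E.
transitivity (\int[mu]_x lebesgue_measure (xsection hypograph x)).
  apply: eq_integral => x _.
  have := f0 x; case fx : (f x) => [r| |]// r0.
    rewrite (_ : xsection _ _ = `]0%R, r[%classic).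
      rewrite lebesgue_measure_itv/= lte_fin; case: ltP => [_|]; first by rewrite sube0.
      by move=> r0'; congr EFin; apply/eqP; rewrite eq_le r0' -lee_fin r0.
    apply/seteqP; split => t; rewrite /xsection/= inE/= /hypograph/= fx lte_fin in_itv/=.
      by move=> [-> ->].
    by move/andP.
  rewrite (_ : xsection _ _ = `]0%R, +oo[%classic).
    by rewrite lebesgue_measure_itv/= ltry.
  apply/seteqP; split => t; rewrite /xsection/= inE/= /hypograph/= fx in_itv/= ?andbT.
    by case.
  by move=> ->; rewrite ltry.
by rewrite E; apply: eq_integral => t _; rewrite /= ysection_hypograph.
Qed.

End layer_cake.

Import HBNNSimple.

(** The range is finite, hence compact, and [x0] makes it nonempty. *)
Lemma nnsfun_attains_max d (T : measurableType d) (R : realType)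
    (f : {nnsfun T >-> R}) (x0 : T) :
  exists x, forall y, (f y <= f x)%R.
Proof.
have [|||_ /set_mem[x _ <-] xmax] := @compact_EVT_max _ _ (@idfun R) (range f).
- by exists (f x0), x0.
- by apply: finite_compact; exact: fimfunP.
- exact: continuous_subspaceT (fun=> cvg_id).
by exists x => y; apply: xmax; rewrite inE; exists y.
Qed.

Section prekopa_leindler1.
Context (R : realType).
Local Notation mu := (@lebesgue_measure R).
Implicit Types f g h : measurableTypeR R -> \bar R.

(* Equal maxima make the superlevel sets of [f] and [g] simultaneously nonempty,
   so that the Brunn-Minkowski inequality applies to them. *)
Lemma prekopa_leindler1_normalized f g h :
  measurable_fun setT f -> measurable_fun setT g -> measurable_fun setT h ->
  (forall x, 0 <= f x <= 1) -> (forall x, 0 <= g x <= 1) ->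
  (forall x, 0 <= h x) ->
  (exists x, f x = 1) -> (exists x, g x = 1) ->
  (forall x y, f x * g y <= h ((x + y) / 2)%R * h ((x + y) / 2)%R) ->
  \int[mu]_x f x + \int[mu]_x g x <= 2%:E * \int[mu]_x h x.
Proof.
move=> mf mg mh f01 g01 h0 [x fx] [y gy] fgh.
have f0 z : 0 <= f z by case/andP: (f01 z).
have g0 z : 0 <= g z by case/andP: (g01 z).
have superlevel0 (u : measurableTypeR R -> \bar R) t :
    ~ (exists x, superlevel u t x) -> mu (superlevel u t) = 0.
  move=> u0; suff -> : superlevel u t = set0 by rewrite measure0.
  by apply/seteqP; split => // z utz; apply: u0; exists z.
have superlevelD t : mu (superlevel f t) + mu (superlevel g t) <=
    2%:E * mu (superlevel h t).
  (* Outside []0, 1[] the superlevel sets of [f] and [g] are empty; inside, both are nonempty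
     because the value 1 is attained. *)
  have [t01|t01] := boolP ((0 < t)%R && (t < 1)%R); last first.
    have sup0 u : (forall z, u z <= 1) -> mu (superlevel u t) = 0.
      move=> u1; apply: superlevel0 => -[z [t0 tu]]; apply/negP: t01.
      by rewrite t0 -lte_fin (lt_le_trans tu).
    by rewrite (sup0 f) ?(sup0 g) ?adde0 ?mule_ge0// => z;
      [case/andP: (g01 z)|case/andP: (f01 z)].
  case/andP: t01 => t0 t1.
  apply: brunn_minkowski1.
  - exact: measurable_superlevel.
  - exact: measurable_superlevel.
  - exact: measurable_superlevel.
  - by exists x; split=> //; rewrite fx lte_fin.
  - by exists y; split=> //; rewrite gy lte_fin.
  (* If [h] were at most [t] at the midpoint, its square would be at most [t * t], which is less
     than [f a * g b]. *)
  move=> a b [_ fa] [_ gb]; split => //; rewrite ltNge; apply/negP => hab.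
  have := fgh a b; rewrite leNgt => /negP; apply.
  apply: (@le_lt_trans _ _ (t%:E * t%:E)); first exact: lee_pmul.
  by apply: lte_pmul => //; rewrite lee_fin ltW.
rewrite (layer_cake mu mf f0) (layer_cake mu mg g0) (layer_cake mu mh h0).
have mF := measurable_fun_superlevel mu mf.
have mG := measurable_fun_superlevel mu mg.
have mH := measurable_fun_superlevel mu mh.
rewrite -ge0_integralD// -ge0_integralZl_EFin//; apply: ge0_le_integral => //.
- by move=> t _; exact: adde_ge0.
- exact: emeasurable_funD.
- exact: measurable_funeM.
by move=> t _; exact: superlevelD.
Qed.

(** Simple functions attain their maxima, so they can be divided by them. Dividing [h] by the
    geometric mean [c] of the two maxima preserves the hypothesis, and the factors cancel in the
    conclusion. If a maximum is 0, so is the left-hand side. *)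
Lemma prekopa_leindler1_nnsfun (f g : {nnsfun measurableTypeR R >-> R}) h :
  measurable_fun setT h -> (forall x, 0 <= h x) ->
  (forall x y, (f x * g y)%:E <= h ((x + y) / 2)%R * h ((x + y) / 2)%R) ->
  (\int[mu]_x (f x)%:E) * (\int[mu]_x (g x)%:E) <=
  (\int[mu]_x h x) * (\int[mu]_x h x).
Proof.
move=> mh h0 fgh; pose z : measurableTypeR R := 0%R.
have [p pmax] := nnsfun_attains_max f z; have [q qmax] := nnsfun_attains_max g z.
have [fp0|fp0] := leP (f p) 0%R.
  rewrite integral0_eq ?mul0e ?mule_ge0 ?integral_ge0// => x _.
  by congr EFin; apply/eqP; rewrite eq_le (le_trans (pmax x))//=.
have [gq0|gq0] := leP (g q) 0%R.
  rewrite [X in _ * X <= _]integral0_eq ?mule0 ?mule_ge0 ?integral_ge0// => x _.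
  by congr EFin; apply/eqP; rewrite eq_le (le_trans (qmax x))//=.
pose c := Num.sqrt (f p * g q).
have c0 : (0 < c)%R by rewrite sqrtr_gt0 mulr_gt0.
have pV0 : (0 <= (f p)^-1)%R by rewrite invr_ge0 ltW.
have qV0 : (0 <= (g q)^-1)%R by rewrite invr_ge0 ltW.
have cV0 : (0 <= c^-1)%R by rewrite invr_ge0 ltW.
have cc : (c^-1 * c^-1 = (f p)^-1 * (g q)^-1)%R.
  by rewrite -!invfM -expr2 sqr_sqrtr// mulr_ge0// ltW.
have mf : measurable_fun setT (EFin \o f) by exact/measurable_EFinP.
have mg : measurable_fun setT (EFin \o g) by exact/measurable_EFinP.
have := @prekopa_leindler1_normalized (fun x => (f p)^-1%:E * (f x)%:E)
  (fun x => (g q)^-1%:E * (g x)%:E) (fun x => c^-1%:E * h x).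
rewrite !ge0_integralZl_EFin//; try by move=> *; rewrite lee_fin.
have fZ x : 0 <= (f p)^-1%:E * (f x)%:E <= 1.
  rewrite -EFinM !lee_fin [X in (X <= 1)%R]mulrC ler_pdivrMr// mul1r pmax andbT.
  exact: mulr_ge0.
have gZ x : 0 <= (g q)^-1%:E * (g x)%:E <= 1.
  rewrite -EFinM !lee_fin [X in (X <= 1)%R]mulrC ler_pdivrMr// mul1r qmax andbT.
  exact: mulr_ge0.
move=> /(_ (measurable_funeM _ mf) (measurable_funeM _ mg) (measurable_funeM _ mh) fZ gZ).
have ZM (u v : R) (x y : \bar R) :
  (u%:E * x) * (v%:E * y) = (u * v)%:E * (x * y).
  by rewrite muleACA.
rewrite muleCA => H.
suff : ((f p)^-1%:E * \int[mu]_x (f x)%:E) * ((g q)^-1%:E * \int[mu]_x (g x)%:E) <=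
  (c^-1%:E * \int[mu]_x h x) * (c^-1%:E * \int[mu]_x h x).
  rewrite !ZM// cc lee_pmul2l// lte_fin mulr_gt0// invr_gt0//.
apply: sqre_ge_mul.
- by rewrite mule_ge0 ?lee_fin ?integral_ge0// => x _; rewrite lee_fin.
- by rewrite mule_ge0 ?lee_fin ?integral_ge0// => x _; rewrite lee_fin.
rewrite [leRHS]muleCA; apply: H.
- by move=> x; rewrite mule_ge0// lee_fin.
- by exists p; rewrite -EFinM mulVf// gt_eqF.
- by exists q; rewrite -EFinM mulVf// gt_eqF.
- move=> x y; rewrite !ZM// cc lee_pmul2l ?lte_fin ?mulr_gt0 ?invr_gt0//.
  exact: fgh.
Qed.

(** Simple functions below [f] and [g] inherit the hypothesis with the same [h], and the integrals
    of [f] and [g] are suprema over them. *)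
Lemma prekopa_leindler1 f g h :
  measurable_fun setT f -> measurable_fun setT g -> measurable_fun setT h ->
  (forall x, 0 <= f x) -> (forall x, 0 <= g x) -> (forall x, 0 <= h x) ->
  (forall x y, f x * g y <= h ((x + y) / 2)%R * h ((x + y) / 2)%R) ->
  (\int[mu]_x f x) * (\int[mu]_x g x) <= (\int[mu]_x h x) * (\int[mu]_x h x).
Proof.
move=> mf mg mh f0 g0 h0 fgh.
rewrite (ge0_integralTE _ f0); apply: ereal_supM_le.
- by exists (sintegral mu (cst_nnsfun _ (NngNum (lexx 0%R))));
    exists (cst_nnsfun _ (NngNum (lexx 0%R))).
- by move=> _ [u _ <-]; exact: sintegral_ge0.
- by apply: integral_ge0.
move=> _ [u /= uf <-].
rewrite muleC (ge0_integralTE _ g0); apply: ereal_supM_le.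
- by exists (sintegral mu (cst_nnsfun _ (NngNum (lexx 0%R))));
    exists (cst_nnsfun _ (NngNum (lexx 0%R))).
- by move=> _ [v _ <-]; exact: sintegral_ge0.
- exact: sintegral_ge0.
move=> _ [v /= vg <-]; rewrite muleC -!integralT_nnsfun.
apply: prekopa_leindler1_nnsfun => // x y.
by apply: le_trans (fgh x y); rewrite EFinM; apply: lee_pmul; rewrite ?lee_fin.
Qed.

End prekopa_leindler1.

(** * The Prekopa-Leindler inequality in dimension n *)

Lemma integral_lebesgue_tupleS (R : realType) n (f : tup R n.+1 -> \bar R) :
  measurable_fun setT f -> (forall t, 0 <= f t) ->
  \int[@lebesgue_tuple R n.+1]_t f t =
  \int[@lebesgue_measure R]_x \int[@lebesgue_tuple R n]_t f (tcons (x, t)).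
Proof.
move=> mf f0.
transitivity (\int[pushforward (@lebesgue_measure R \x @lebesgue_tuple R n)
    (@tcons R n)]_t f t) => //.
rewrite ge0_integral_pushforward//; last exact: measurable_tcons.
rewrite preimage_setT fubini_tonelli1//.
- by apply: measurableT_comp => //; exact: measurable_tcons.
- by move=> p; exact: f0.
Qed.

Lemma measurable_tcons1 (R : realType) n (x : measurableTypeR R) :
  measurable_fun setT (fun t : tup R n => tcons (x, t)).
Proof.
apply: (measurableT_comp (measurable_tcons (R:=R) (n:=n))).
exact: measurable_fun_pair.
Qed.

Lemma measurable_fun_section_integral (R : realType) n (f : tup R n.+1 -> \bar R) :
  measurable_fun setT f -> (forall t, 0 <= f t) ->
  measurable_fun setT
    (fun x => \int[@lebesgue_tuple R n]_t f (tcons (x, t))).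
Proof.
move=> mf f0.
apply: (@measurable_fun_fubini_tonelli_F _ _ _ _ _ (@lebesgue_tuple R n)
  (f \o @tcons R n)) => //.
- by apply: measurableT_comp => //; exact: measurable_tcons.
- by move=> p; exact: f0.
Qed.

Definition tmid (R : realType) n (x y : tup R n) : tup R n :=
  [tuple ((tnth x i + tnth y i) / 2)%R | i < n].

Lemma tmid_tcons (R : realType) n (a b : measurableTypeR R) (x y : tup R n) :
  tmid (tcons (a, x)) (tcons (b, y)) = tcons (((a + b) / 2)%R, tmid x y).
Proof.
apply: eq_from_tnth => i; rewrite tnth_mktuple.
by case: (unliftP ord0 i) => [j|] ->; rewrite ?tnthS ?tnth0 ?tnth_mktuple.
Qed.

(** By induction on [n]. For first coordinates [a] and [b], the induction hypothesis on the slices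
    says that the slice integrals satisfy the hypothesis of the inequality on the line. In dimension
    0 the integrals are values at the empty tuple. *)
Lemma prekopa_leindler (R : realType) n (f g h : tup R n -> \bar R) :
  measurable_fun setT f -> measurable_fun setT g -> measurable_fun setT h ->
  (forall x, 0 <= f x) -> (forall x, 0 <= g x) -> (forall x, 0 <= h x) ->
  (forall x y, f x * g y <= h (tmid x y) * h (tmid x y)) ->
  (\int[@lebesgue_tuple R n]_x f x) * (\int[@lebesgue_tuple R n]_x g x) <=
  (\int[@lebesgue_tuple R n]_x h x) * (\int[@lebesgue_tuple R n]_x h x).
Proof.
elim: n => [|n IH] in f g h * => mf mg mh f0 g0 h0 fgh.
  rewrite !integral_dirac// diracT !mul1e.
  have := fgh [tuple] [tuple]; rewrite (_ : tmid _ _ = [tuple])//.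
  by rewrite [LHS]tuple0.
rewrite (integral_lebesgue_tupleS mf f0) (integral_lebesgue_tupleS mg g0).
rewrite (integral_lebesgue_tupleS mh h0).
apply: prekopa_leindler1.
- exact: measurable_fun_section_integral.
- exact: measurable_fun_section_integral.
- exact: measurable_fun_section_integral.
- by move=> x; exact: integral_ge0.
- by move=> x; exact: integral_ge0.
- by move=> x; exact: integral_ge0.
move=> a b; apply: IH => // [|||x y]; last by rewrite -tmid_tcons.
- by apply: measurableT_comp => //; exact: measurable_tcons1.
- by apply: measurableT_comp => //; exact: measurable_tcons1.
- by apply: measurableT_comp => //; exact: measurable_tcons1.
Qed.

(** * Affine changes of variables and the volume of cubes *)

Lemma ge0_integral_affine (R : realType) (a b : R)
    (f : measurableTypeR R -> \bar R) : (0 < a)%R ->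
  measurable_fun setT f -> (forall x, 0 <= f x) ->
  \int[@lebesgue_measure R]_x f (affine a b x) =
  (a^-1)%:E * \int[@lebesgue_measure R]_x f x.
Proof.
move=> a0 mf f0; have maff := @measurable_affine R a b.
have aV0 : (0 <= a^-1)%R by rewrite invr_ge0 ltW.
have := @ge0_integral_pushforward _ _ _ _ R _ maff (@lebesgue_measure R) setT f.
rewrite preimage_setT => /= <-//.
rewrite -(ge0_integral_mscale (@lebesgue_measure R) _ (NngNum aV0))//.
by apply: eq_measure_integral => A mA _; exact: lebesgue_measure_affine.
Qed.

Definition taffine (R : realType) n (a : R) (b t : tup R n) : tup R n :=
  [tuple affine a (tnth b i) (tnth t i) | i < n].

Lemma measurable_taffine (R : realType) n (a : R) (b : tup R n) :
  measurable_fun setT (taffine a b).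
Proof.
apply/measurable_fun_tnthP => i.
rewrite (_ : _ \o _ = affine a (tnth b i) \o (@tnth _ _ ^~ i)).
  apply: measurableT_comp; [exact: measurable_affine|exact: measurable_tnth].
by apply/funext => t; rewrite /= tnth_mktuple.
Qed.

Lemma taffine_tcons (R : realType) n (a : R) (b x : measurableTypeR R)
    (c t : tup R n) :
  taffine a (tcons (b, c)) (tcons (x, t)) = tcons (affine a b x, taffine a c t).
Proof.
apply: eq_from_tnth => i; rewrite tnth_mktuple.
by case: (unliftP ord0 i) => [j|] ->; rewrite ?tnthS ?tnth0 ?tnth_mktuple.
Qed.

(** The change of variables on the line gives one factor [a^-1] for the first coordinate, and the
    induction hypothesis gives the others. *)
Lemma ge0_integral_taffine (R : realType) n (a : R) (b : tup R n)
    (f : tup R n -> \bar R) : (0 < a)%R ->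
  measurable_fun setT f -> (forall x, 0 <= f x) ->
  \int[@lebesgue_tuple R n]_t f (taffine a b t) =
  (a ^- n)%:E * \int[@lebesgue_tuple R n]_t f t.
Proof.
move=> a0; elim: n => [|n IH] in b f * => mf f0.
  rewrite expr0 invr1 mul1e; apply: eq_integral => t _.
  by rewrite (tuple0 t) (tuple0 (taffine _ _ _)).
have an0 : (0 <= a ^- n)%R by rewrite invr_ge0 exprn_ge0// ltW.
have mft := measurableT_comp mf (measurable_taffine a b).
rewrite (integral_lebesgue_tupleS mf f0).
rewrite (integral_lebesgue_tupleS mft (fun=> f0 _)).
have mI := measurable_fun_section_integral mf f0.
rewrite exprS invfM EFinM -muleA [in RHS]muleC -muleA [X in _ = _ * X]muleC.
rewrite -(ge0_integral_affine (thead b))//; last first.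
  by move=> x; exact: integral_ge0.
rewrite -ge0_integralZl_EFin//; first last.
- apply: (measurableT_comp mI); exact: measurable_affine.
- by move=> x _; exact: integral_ge0.
apply: eq_integral => x _; rewrite -(IH [tuple of behead b])//; last first.
  by apply: measurableT_comp => //; exact: measurable_tcons1.
apply: eq_integral => t _.
by rewrite -taffine_tcons -[tcons (thead b, _)]/(tcons (tuncons b)) tunconsK.
Qed.

Lemma lebesgue_tuple_taffine (R : realType) n (a : R) (b : tup R n)
    (A : set (tup R n)) : (0 < a)%R -> measurable A ->
  lebesgue_tuple (taffine a b @^-1` A) = (a ^- n)%:E * lebesgue_tuple A.
Proof.
move=> a0 mA.
have mA' : measurable (taffine a b @^-1` A).
  by rewrite -[X in measurable X]setTI; exact: measurable_taffine.
rewrite -[in RHS](setIT A) -[in LHS](setIT (_ @^-1` _)) -!integral_indic//.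
rewrite -(ge0_integral_taffine b)//.
by exact/measurable_EFinP/measurable_indic.
Qed.

Lemma measurable_tbox (R : realType) n (F : 'I_n -> set (measurableTypeR R)) :
  (forall i, measurable (F i)) ->
  measurable [set t : tup R n | forall i, F i (tnth t i)].
Proof.
move=> mF; rewrite (_ : mkset _ = \bigcap_(i in [set: 'I_n])
    ((@tnth _ _ ^~ i) @^-1` F i)).
  apply: fin_bigcap_measurable; first exact: finite_finset.
  by move=> i _; rewrite -[X in measurable X]setTI; exact: measurable_tnth.
by apply/seteqP; split => t Ft i; [move=> _; exact: Ft|exact: Ft].
Qed.

Definition tcube (R : realType) n (b : tup R n) (l : R) : set (tup R n) :=
  [set t | forall i, (tnth b i <= tnth t i <= tnth b i + l)%R].

Lemma measurable_tcube (R : realType) n (b : tup R n) (l : R) :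
  measurable (tcube b l).
Proof.
rewrite (_ : tcube b l = [set t | forall i,
    `[tnth b i, (tnth b i + l)%R]%classic (tnth t i)]).
  apply: (@measurable_tbox R n
    (fun i => `[tnth b i, (tnth b i + l)%R]%classic)) => i.
  exact: measurable_itv.
by apply/seteqP; split => t bt i; have := bt i; rewrite /= in_itv.
Qed.

Lemma lebesgue_tuple_tcube (R : realType) n (b : tup R n) (l : R) :
  (0 <= l)%R -> lebesgue_tuple (tcube b l) = (l ^+ n)%:E.
Proof.
move=> l0; elim: n => [|n IH] in b *.
  by rewrite /= diracE mem_set//= => -[].
rewrite -(tunconsK b); case: (tuncons b) => x c {b}.
pose I : set (measurableTypeR R) := `[x, (x + l)%R]%classic.
have mI : measurable I by exact: measurable_itv.
have mC := measurable_tcube c l.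
transitivity ((@lebesgue_measure R \x @lebesgue_tuple R n) (I `*` tcube c l)).
  rewrite /= /pushforward; congr product_measure1.
  apply/seteqP; split => -[y t]; rewrite /preimage/=.
    move=> yt; split => [|i].
      by have := yt ord0; rewrite !tnth0 /I/= in_itv.
    by have := yt (lift ord0 i); rewrite !tnthS.
  move=> [+ ct] i; rewrite /I/= in_itv/= => xy.
  by case: (unliftP ord0 i) => [j|] ->; rewrite ?tnthS ?tnth0//; exact: ct.
rewrite product_measure1E//= ?IH//.
rewrite lebesgue_measure_itv/= lte_fin exprS EFinM; congr (_ * _).
case: ltP => ?; first by rewrite -EFinB; congr EFin; lra.
by congr EFin; lra.
Qed.

Local Close Scope ereal_scope.

(** * Balls, cubes and midpoints *)

Section geometry.
Context (R : realType) (n : nat).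
Implicit Types (a b c m t x y : tup R n) (A B K L : set (tup R n)).
Local Notation mu := (@lebesgue_tuple R n).

Lemma measurable_mu_ext_tuple A : measurable A -> mu_ext mu A = mu A.
Proof. exact: measurable_mu_extE. Qed.

Definition sqdist x y : R := \sum_(i < n) (tnth x i - tnth y i) ^+ 2.

Lemma sqdist_ge0 x y : 0 <= sqdist x y.
Proof. by apply: sumr_ge0 => i _; exact: sqr_ge0. Qed.

Lemma measurable_fun_sqdist c : measurable_fun setT (sqdist c).
Proof.
apply: measurable_sum => i; apply: measurable_funX.
by apply: measurable_funB => //; exact: measurable_tnth.
Qed.

(** The parallelogram law, checked coordinate by coordinate. *)
Lemma sqdist_tmid c x y :
  sqdist c (tmid x y) = (sqdist c x + sqdist c y) / 2 - sqdist x y / 4.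
Proof.
rewrite /sqdist -big_split/= !mulr_suml -sumrB; apply: eq_bigr => i _.
by rewrite tnth_mktuple; field.
Qed.

Definition tball c (r : R) : set (tup R n) := [set t | sqdist c t < r ^+ 2].

Lemma measurable_tball c (r : R) : measurable (tball c r).
Proof.
have /(_ measurableT [set true]) := measurable_fun_ltr
  (measurable_fun_sqdist c) (@measurable_cst _ _ _ _ setT (r ^+ 2)).
by rewrite setTI; apply.
Qed.

Lemma lebesgue_tuple_tball c (r s : R) : 0 < r -> 0 < s ->
  mu (tball c s) = (((s / r) ^+ n)%:E * mu (tball c r))%E.
Proof.
move=> r0 s0; have a0 : 0 < r / s by rewrite divr_gt0.
(* This translation makes the dilation of ratio [r / s] fix the centre [c]. *)
pose b := [tuple tnth c i - (r / s) * tnth c i | i < n].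
rewrite (_ : tball c s = taffine (r / s) b @^-1` tball c r); last first.
  apply/seteqP; suff E t : sqdist c (taffine (r / s) b t) = (r / s) ^+ 2 * sqdist c t.
    by split=> t; rewrite /preimage/tball/= E -ltr_pdivlMl ?exprn_gt0//;
      rewrite -exprVn -exprMn invf_div divfK// gt_eqF.
  rewrite /sqdist mulr_sumr; apply: eq_bigr => i _.
  by rewrite !tnth_mktuple /affine; ring.
rewrite lebesgue_tuple_taffine//; last exact: measurable_tball.
by rewrite -exprVn invf_div.
Qed.

(** Otherwise a cube centred at [c] with side [l > 1] fits in the ball, since its squared
    half-diagonal is [n l ^ 2 / 4], and its volume [l ^ n] exceeds 1. *)
Lemma tball_radius c (r : R) : (0 < n)%N -> 0 < r -> (mu (tball c r) <= 1)%E ->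
  4 * r ^+ 2 <= n%:R.
Proof.
move=> n0 r0 mur; rewrite leNgt; apply/negP => nr.
have nR0 : 0 < n%:R :> R by rewrite ltr0n.
pose q := 4 * r ^+ 2 / n%:R.
have q1 : 1 < q by rewrite ltr_pdivlMr// mul1r.
(* [l ^ 2] is halfway between 1 and [q], so that both [1 < l] and [n l ^ 2 < 4 r ^ 2] hold. *)
pose l := Num.sqrt ((1 + q) / 2).
have l2 : l ^+ 2 = (1 + q) / 2 by rewrite sqr_sqrtr//; lra.
have l0 : 0 <= l by exact: sqrtr_ge0.
have l1 : 1 < l by rewrite -(ltr_pXn2r (n := 2)) ?nnegrE// expr1n l2; lra.
have lq : n%:R * l ^+ 2 < 4 * r ^+ 2.
  by rewrite mulrC -ltr_pdivlMr// -/q l2; lra.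
pose b := [tuple tnth c i - l / 2 | i < n].
have CB : tcube b l `<=` tball c r.
  move=> t Ct; rewrite /tball/=.
  apply: (@le_lt_trans _ _ (\sum_(i < n) (l ^+ 2 / 4))).
    apply: ler_sum => i _; have := Ct i; rewrite tnth_mktuple => /andP[t1 t2].
    have : 0 <= (l / 2 - (tnth c i - tnth t i)) * (l / 2 + (tnth c i - tnth t i)).
      by apply: mulr_ge0; lra.
    lra.
  by rewrite sumr_const card_ord -mulr_natl; lra.
have : (mu (tcube b l) <= mu (tball c r))%E.
  apply: le_measure => //; rewrite inE; first exact: measurable_tcube.
  exact: measurable_tball.
rewrite lebesgue_tuple_tcube// => /le_trans /(_ mur).
by rewrite leNgt lte_fin exprn_egt1 ?gtn_eqF.
Qed.

(* A Borel superset of [A] contained in its closure: the points that share a grid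
   cell of side [1 / k.+1] with a point of [A], for every [k]. *)
Definition tclosure A : set (tup R n) :=
  \bigcap_k [set t | exists2 a, A a & forall i,
    Num.floor (k.+1%:R * tnth t i) = Num.floor (k.+1%:R * tnth a i)].

Lemma subset_tclosure A : A `<=` tclosure A.
Proof. by move=> a Aa k _; exists a. Qed.

(** For each [k] the set is the union of the grid cells that meet [A]. There are countably many
    cells, each a product of half-open intervals. *)
Lemma measurable_tclosure A : measurable (tclosure A).
Proof.
apply: bigcapT_measurable => k.
pose cell (z : n.-tuple int) : set (tup R n) :=
  [set t | forall i, [set u : measurableTypeR R |
    Num.floor (k.+1%:R * (u : R)) = tnth z i] (tnth t i)].
rewrite (_ : mkset _ = \bigcup_z [set t | cell z t /\ exists2 a, A a & cell z a]).
  apply: countable_bigcupT_measurable => // z.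
  have [Az|Az] := pselect (exists2 a, A a & cell z a); last first.
    by rewrite (_ : mkset _ = set0)//; apply/seteqP; split=> // t [].
  rewrite (_ : mkset _ = cell z); last by apply/seteqP; split=> // t [].
  apply: (@measurable_tbox R n (fun i => [set u : measurableTypeR R |
    Num.floor (k.+1%:R * (u : R)) = tnth z i])) => i.
  rewrite (_ : mkset _ = `[(tnth z i)%:~R / k.+1%:R,
    (tnth z i + 1)%:~R / k.+1%:R[%classic); first exact: measurable_itv.
  apply/seteqP; split => u /=; rewrite in_itv/= ler_pdivrMr// ltr_pdivlMr// mulrC.
    by move=> <-; exact: floor_itv.
  by move=> /floor_def.
apply/seteqP; split => t /=.
  move=> [a Aa ta]; exists [tuple Num.floor (k.+1%:R * (tnth t i : R)) | i < n] => //.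
  by split=> [i|]/=; [|exists a => // i /=]; rewrite tnth_mktuple.
by move=> [z _ [zt [a Aa za]]]; exists a => // i; rewrite (zt i) (za i).
Qed.

Lemma tclosure_approx A x (k : nat) : tclosure A x ->
  exists2 a, A a & forall i, `|tnth x i - tnth a i| <= k.+1%:R^-1.
Proof.
move=> /(_ k Logic.I)[a Aa xa]; exists a => // i.
have k0 : 0 < k.+1%:R :> R by rewrite ltr0n.
have := floor_itv (k.+1%:R * (tnth x i : R)).
have := floor_itv (k.+1%:R * (tnth a i : R)).
rewrite (xa i) => /andP[a1 a2] /andP[x1 x2].
rewrite -[leRHS]div1r ler_pdivlMr// -[X in _ * X](gtr0_norm k0) -normrM.
by rewrite ler_norml; rewrite intrD in a2 x2; apply/andP; split; lra.
Qed.

Lemma sqdist_tclosure_mid A B c (s : R) :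
  (forall a b, A a -> B b -> sqdist c (tmid a b) <= s) ->
  forall x y, tclosure A x -> tclosure B y -> sqdist c (tmid x y) <= s.
Proof.
move=> ABs x y Ax By; rewrite leNgt; apply/negP => sxy.
have s0 : 0 <= s.
  have [a Aa _] := tclosure_approx 0 Ax; have [b Bb _] := tclosure_approx 0 By.
  by rewrite (le_trans _ (ABs _ _ Aa Bb))// sqdist_ge0.
(* Moving each coordinate of [x] and [y] by at most [e] changes the bound [s] by at most
   [e * (s + 2 n)]; the extra 1 makes the denominator positive. *)
have den : 0 < s + 2 * n%:R + 1 :> R.
  by rewrite ltr_wpDl// addr_ge0// mulr_ge0.
have : 0 < (sqdist c (tmid x y) - s) / (s + 2 * n%:R + 1).
  by rewrite divr_gt0// subr_gt0.
move=> /ltr_add_invr[k]; rewrite add0r ltr_pdivlMr//.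
set e := k.+1%:R^-1; have e0 : 0 < e :> R by rewrite invr_gt0 ltr0n.
have e1 : e <= 1 by rewrite invf_le1 ?ltr0n// ler1n.
rewrite ltrBrDl; apply/negP; rewrite -leNgt.
have [a Aa xa] := tclosure_approx k Ax; have [b Bb yb] := tclosure_approx k By.
have := ABs _ _ Aa Bb; set m := tmid a b => sm.
(* In each coordinate, [(u + v) ^ 2 <= (1 + e) u ^ 2 + 2 e] whenever [|v| <= e <= 1]. *)
apply: (@le_trans _ _ (\sum_(i < n) ((1 + e) * (tnth c i - tnth m i) ^+ 2 + 2 * e))).
  apply: ler_sum => i _; rewrite !tnth_mktuple.
  have := xa i; have := yb i; rewrite -/e !ler_norml => /andP[y1 y2] /andP[x1 x2].
  set u := tnth c i - (tnth a i + tnth b i) / 2.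
  set v := (tnth a i + tnth b i) / 2 - (tnth x i + tnth y i) / 2.
  have -> : tnth c i - (tnth x i + tnth y i) / 2 = u + v by rewrite /u /v; ring.
  have v1 : - e <= v by rewrite /v; lra.
  have v2 : v <= e by rewrite /v; lra.
  have ve : v ^+ 2 <= e ^+ 2.
    by have : 0 <= (e - v) * (e + v) by [apply: mulr_ge0; lra]; lra.
  have ee : e ^+ 2 <= e by rewrite expr2 ler_piMr// ltW.
  (* [2 u v <= 2 e |u| <= e (1 + u ^+ 2)] *)
  have uv : 0 <= e * (u - 1) ^+ 2 by rewrite mulr_ge0 ?sqr_ge0// ltW.
  have uv' : 0 <= e * (u + 1) ^+ 2 by rewrite mulr_ge0 ?sqr_ge0// ltW.
  have [u0|u0] := leP 0 u.
    have : 0 <= u * (e - v) by rewrite mulr_ge0//; lra.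
    lra.
  have : 0 <= (- u) * (e + v) by rewrite mulr_ge0//; lra.
  lra.
rewrite big_split/= -mulr_sumr sumr_const card_ord -/(sqdist c m) -mulr_natl.
have : (1 + e) * sqdist c m <= (1 + e) * s by rewrite ler_pM2l//; lra.
lra.
Qed.

End geometry.

(** The Prekopa-Leindler inequality for the indicators of the two Borel hulls and of [M]; the hulls
    bound the outer measures of [A] and [B] from above. *)
Lemma brunn_minkowski_tclosure (R : realType) n (A B M : set (tup R n)) :
  measurable M ->
  (forall x y, tclosure A x -> tclosure B y -> M (tmid x y)) ->
  (mu_ext (@lebesgue_tuple R n) A * mu_ext (@lebesgue_tuple R n) B <=
   lebesgue_tuple M * lebesgue_tuple M)%E.
Proof.
move=> mM ABM; pose mu := @lebesgue_tuple R n.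
have leK (X : set (tup R n)) : (mu_ext mu X <= mu (tclosure X))%E.
  rewrite /mu -(measurable_mu_ext_tuple (measurable_tclosure X)).
  by apply: le_mu_ext; exact: subset_tclosure.
apply: (@le_trans _ _ (mu (tclosure A) * mu (tclosure B))%E).
  by apply: lee_pmul => //; exact: mu_ext_ge0.
have mA := measurable_tclosure A; have mB := measurable_tclosure B.
have indicI (X : set (tup R n)) : measurable X ->
    (mu X = \int[mu]_x (\1_X x)%:E)%E.
  by move=> mX; rewrite integral_indic// setIT.
rewrite -/mu (indicI _ mA) (indicI _ mB) (indicI _ mM).
apply: prekopa_leindler.
- exact/measurable_EFinP/measurable_indic.
- exact/measurable_EFinP/measurable_indic.
- exact/measurable_EFinP/measurable_indic.
- by move=> x; rewrite lee_fin.
- by move=> x; rewrite lee_fin.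
- by move=> x; rewrite lee_fin.
move=> x y; rewrite !indicE -!EFinM lee_fin.
case: (boolP (x \in tclosure A)) => [/set_mem Ax|_]; last by rewrite mul0r mulr_ge0.
case: (boolP (y \in tclosure B)) => [/set_mem By|_]; last by rewrite mulr0 mulr_ge0.
by rewrite (mem_set (ABM _ _ Ax By)).
Qed.

(** * Passage from row vectors to tuples, and the final estimate *)

Definition pull (R : realType) n (A : set 'rV[R]_n) : set (tup R n) :=
  [set t | A (\row_(i < n) tnth t i)].

Lemma eucl_dist_row (R : realType) n (x y : tup R n) :
  eucl_dist (\row_(i < n) (tnth x i : R)) (\row_(i < n) (tnth y i : R)) =
  Num.sqrt (sqdist x y).
Proof. by congr Num.sqrt; apply: eq_bigr => i _; rewrite !mxE. Qed.

(** This treats open and closed balls at once: the inner inclusion serves for volumes, the outer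
    bound for distances. *)
Lemma eucl_ballP (R : realType) n (S : set 'rV[R]_n) : eucl_ball S ->
  exists c (r : R), [/\ 0 < r, tball c r `<=` pull S &
    forall t, pull S t -> sqdist c t <= r ^+ 2].
Proof.
move=> [C [r [r0 SE]]]; pose c : tup R n := [tuple C 0 i | i < n].
have cE : C = \row_(i < n) tnth c i.
  by apply/rowP => i; rewrite mxE tnth_mktuple.
exists c, r; split => //.
  move=> t; rewrite /tball/pull/= => ct.
  have lt_r : eucl_dist C (\row_(i < n) (tnth t i : R)) < r.
    by rewrite cE eucl_dist_row -[ltRHS](gtr0_norm r0) -sqrtr_sqr ltr_sqrt ?exprn_gt0.
  by case: SE => ->//=; exact: ltW.
move=> t St.
have : eucl_dist C (\row_(i < n) (tnth t i : R)) <= r.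
  by case: SE St => -> //=; rewrite /pull/= => /ltW.
rewrite cE eucl_dist_row => sr.
by rewrite -(sqr_sqrtr (sqdist_ge0 _ _)) lerXn2r// nnegrE// ltW.
Qed.

Lemma set_dist_le_sqdist (R : realType) n (A B : set 'rV[R]_n) x y :
  0 <= set_dist A B -> pull A x -> pull B y ->
  set_dist A B ^+ 2 <= sqdist x y.
Proof.
move=> d0 Ax By; rewrite -(sqr_sqrtr (sqdist_ge0 _ _)) lerXn2r ?nnegrE//.
rewrite -eucl_dist_row; apply: ge_inf; last first.
  by exists (\row_(i < n) (tnth x i : R)) => //; exists (\row_(i < n) (tnth y i : R)).
by exists 0 => _ [X _ [Y _ <-]]; exact: sqrtr_ge0.
Qed.

Theorem theorem1 (R : realType) (eps : R) (heps0 : 0 < eps) (heps1 : eps < 1 / 2) :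
  exists D : R, forall (n : nat), (1 <= n)%N ->
    forall S A B : set 'rV[R]_n,
      eucl_ball S -> volume S = 1%E ->
      A `<=` S -> B `<=` S ->
      convex_set A -> convex_set B ->
      volume A = eps%:E -> volume B = eps%:E ->
      set_dist A B <= D.
Proof.
exists eps^-1 => n n0 S A B /eucl_ballP[c [r [r0 rS Sr]]] S1 AS BS _ _ vA vB.
rewrite leNgt; apply/negP => dist_gt.
set d := set_dist A B in dist_gt; pose D := eps^-1; rewrite -/D in dist_gt.
have D0 : 0 < D by rewrite invr_gt0.
have d0 : 0 < d by exact: lt_trans dist_gt.
have dD : D ^+ 2 < d ^+ 2 by rewrite ltr_pXn2r// nnegrE ltW.
have mur : (lebesgue_tuple (tball c r) <= 1)%E.
  by rewrite -(measurable_mu_ext_tuple (measurable_tball c r)) -S1 le_mu_ext.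
have rn := tball_radius n0 r0 mur.
have mid_close a b : pull A a -> pull B b -> sqdist c (tmid a b) <= r ^+ 2 - d ^+ 2 / 4.
  move=> Aa Bb; rewrite sqdist_tmid.
  have := Sr _ (AS _ Aa); have := Sr _ (BS _ Bb).
  by have := set_dist_le_sqdist (ltW d0) Aa Bb; rewrite -/d; lra.
have nonempty (X : set 'rV[R]_n) : volume X = eps%:E -> pull X !=set0.
  move=> vX; apply/set0P/eqP => X0; move: vX.
  rewrite /volume -/(pull X) X0 mu_ext0// => -[] eps0.
  by rewrite eps0 ltxx in heps0.
have [a Aa] := nonempty _ vA; have [b Bb] := nonempty _ vB.
(* Some midpoint exists, so [0 <= r ^ 2 - d ^ 2 / 4], and [D < d] makes the inequality strict. *)
have s0 : 0 < r ^+ 2 - D ^+ 2 / 4.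
  by have := mid_close _ _ Aa Bb; have := sqdist_ge0 c (tmid a b); lra.
pose s := Num.sqrt (r ^+ 2 - D ^+ 2 / 4).
have s2 : s ^+ 2 = r ^+ 2 - D ^+ 2 / 4 by rewrite sqr_sqrtr// ltW.
(* Only the weak bound with [d] survives the passage to closures; the gap between [D] and [d] puts
   the midpoints in the open ball. *)
have mid_ball x y : tclosure (pull A) x -> tclosure (pull B) y -> tball c s (tmid x y).
  move=> Ax By; rewrite /tball/= s2.
  by have := sqdist_tclosure_mid mid_close Ax By; lra.
have := brunn_minkowski_tclosure (measurable_tball c s) mid_ball.
rewrite -/(volume A) -/(volume B) vA vB (lebesgue_tuple_tball c r0) ?sqrtr_gt0//.
apply/negP; rewrite -ltNge.
(* [(s / r) ^ 2 = 1 - D ^ 2 / (4 r ^ 2) <= 1 - D ^ 2 / n], as [4 r ^ 2 <= n]; then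
   [1 + x <= exp x]. *)
have sr_le : (s / r) ^+ 2 <= expR (- (D ^+ 2 / n%:R)).
  apply: le_trans (expR_ge1Dx _); rewrite expr_div_n s2 mulrBl divff ?gt_eqF ?exprn_gt0//.
  rewrite lerD2l lerN2 -[leRHS]mulrA -invfM ler_pM2l ?exprn_gt0// lef_pV2 ?posrE ?ltr0n//.
  by rewrite mulr_gt0// exprn_gt0.
have sr_n : (s / r) ^+ n * (s / r) ^+ n <= expR (- D ^+ 2).
  rewrite -exprD addnn -mul2n exprM.
  rewrite (le_trans (lerXn2r n _ _ sr_le)) ?nnegrE ?sqr_ge0 ?expR_ge0//.
  by rewrite -expRM_natl mulrN mulrCA divff ?mulr1// pnatr_eq0 -lt0n.
(* [exp (D ^ 2) >= 1 + D ^ 2 > D ^ 2], and [D] is the inverse of [eps]. *)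
have exp_lt : expR (- D ^+ 2) < eps * eps.
  have -> : eps * eps = (D ^+ 2)^-1 by rewrite exprVn invrK expr2.
  rewrite expRN ltf_pV2 ?posrE ?expR_gt0 ?exprn_gt0//.
  by apply: lt_le_trans (expR_ge1Dx _); rewrite ltrDr.
have q0 : 0 <= (s / r) ^+ n by rewrite exprn_ge0// divr_ge0 ?sqrtr_ge0 ?ltW.
have volq : ((((s / r) ^+ n)%:E * lebesgue_tuple (tball c r) <= ((s / r) ^+ n)%:E))%E.
  by rewrite -[leRHS]mule1; apply: lee_pmul; rewrite ?lee_fin.
apply: (@le_lt_trans _ _ (((s / r) ^+ n)%:E * ((s / r) ^+ n)%:E)%E).
  by apply: lee_pmul => //; apply: mule_ge0 => //; rewrite lee_fin.
by rewrite -!EFinM lte_fin; exact: le_lt_trans sr_n exp_lt.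
Qed.
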